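(* Let $\mathcal{G}$ be a closed subgroup of $\mathcal{O}(d)$, let $G^*\in\mathcal{G}^n$ be the ground truth, let $E\subseteq\{(i,j)\in[n]^2: i<j\}$, let $C_{ij}\in\mathbb{R}^{d\times d}$, $(i,j)\in E$, be observations, and let $\{G^t\}_{t\ge 0}$ be generated by the generalized power method $G^{t+1}=\Pi^n(CG^t)$ from an initial point $G^0\in\mathcal{G}^n$. For $t\ge 0$ let $Q^t\in\operatorname{argmin}_{Q\in\mathcal{G}}\|G^t-G^*Q\|_F$. Suppose that (i) there exists a constant $\alpha\ge 1$ such that for any $t\ge 0$, $\|{G^*}^\top G^t-n\cdot Q^t\|_F\le\frac{\alpha}{2}\|G^t-G^*Q^t\|_F^2$; (ii) $\kappa\le\frac{1}{32}$; (iii) $\|D^{-1}\Delta\|\le\frac1{32}$ and $\|\Pi^n(G^*+2D^{-1}\Delta G^* )-G^*\|_F\le\frac{(\sqrt2-1)\sqrt n}{48\alpha}$; (iv) $\varepsilon(G^0)\le\frac{\sqrt n}{8\alpha}$. Then for all $t\ge 1$, $$\varepsilon(G^t)\le\left(\frac1{\sqrt2}\right)^t\varepsilon(G^0)+6(\sqrt2+1)\,\|\Pi^n(G^*+2D^{-1}\Delta G^* )-G^*\|_F.$$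
   Context: Here $d,n\ge1$ are integers, $[n]=\{1,\dots,n\}$, $\mathcal{O}(d)$ is the group of $d\times d$ real orthogonal matrices, $\|\cdot\|$ is the operator norm and $\|\cdot\|_F$ the Frobenius norm. For an $nd\times nd$ (resp. $nd\times d$) matrix $Y$, $[Y]_{ij}$ (resp. $[Y]_i$) is its $(i,j)$-th (resp. $i$-th) $d\times d$ block. $\mathcal{G}^n$ is viewed as the set of $G\in\mathbb{R}^{nd\times d}$ with all $[G]_i\in\mathcal{G}$; write $G^*_i=[G^*]_i$. For $X\in\mathbb{R}^{d\times d}$, $\Pi(X)\in\operatorname{argmin}_{Q\in\mathcal{G}}\|X-Q\|_F$ (if there are several minimizers, any choice is allowed). For $Y\in\mathbb{R}^{nd\times d}$, $\Pi^n(Y)\in\mathcal{G}^n$ is defined by $[\Pi^n(Y)]_i=\Pi([Y]_i)$. Estimation error: $\varepsilon(G)=\min_{Q\in\mathcal{G}}\|G-G^*Q\|_F$ for $G\in\mathcal{G}^n$. The matrix $C\in\mathbb{R}^{nd\times nd}$ has blocks $[C]_{ij}=C_{ij}$ if $(i,j)\in E$, $C_{ji}^\top$ if $(j,i)\in E$, $I_d$ if $i=j$, and $\mathbf 0$ otherwise. Set $w_{ij}=1$ if $i=j$ or $(i,j)\in E$ or $(j,i)\in E$, and $w_{ij}=0$ otherwise; $r_i=\sum_{j=1}^n w_{ij}\ge 1$. Let $D=\mathrm{Diag}(r_1,\dots,r_n)\otimes I_d$, $W=\bar W\otimes I_d$ with $\bar W=(w_{ij})_{i,j}$, $F=ee^\top\otimes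 I_d$ with $e\in\mathbb{R}^n$ the all-one vector, and $\kappa=\|D^{-1}W-\frac1nF\|$. The matrix $\Delta\in\mathbb{R}^{nd\times nd}$ has blocks $[\Delta]_{ij}=w_{ij}\left([C]_{ij}-G^*_i{G^*_j}^\top\right)$. *)

(* Defs.v *)
From mathcomp Require Import all_boot all_order all_algebra.
From mathcomp Require Import all_classical all_reals all_analysis.

Set Implicit Arguments.
Unset Strict Implicit.
Unset Printing Implicit Defensive.

Import Order.TTheory GRing.Theory Num.Theory.
Import numFieldNormedType.Exports.

Local Open Scope classical_set_scope.
Local Open Scope ring_scope.

(* The norm `|A| that mathcomp-analysis puts on matrices is the max norm; it
   induces the usual topology (used for [closed]) but is neither of the two
   norms below. *)
Definition frob (R : realType) (m n : nat) (A : 'M[R]_(m, n)) : R :=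
  Num.sqrt (\sum_i \sum_j A i j ^+ 2).

(* [frob x] is the Euclidean norm when x is a column vector. *)
Definition opnorm (R : realType) (m n : nat) (A : 'M[R]_(m, n)) : R :=
  sup [set frob (A *m x) | x in [set x : 'cV[R]_n | frob x <= 1]].

Definition argmin (R : realType) (T : Type) (A : set T) (f : T -> R) : set T :=
  [set x | A x /\ forall y, A y -> f x <= f y].

(* The infimum, hence the minimum whenever it is attained ([minvalE]). *)
Definition minval (R : realType) (T : Type) (A : set T) (f : T -> R) : R :=
  inf (f @` A).

Lemma minvalE (R : realType) (T : Type) (A : set T) (f : T -> R) (x : T) :
  argmin A f x -> minval A f = f x.
Proof.
move=> [Ax minx]; apply/eqP; rewrite eq_le; apply/andP; split.
  apply: ge_inf; last by exists x.
  by exists (f x) => _ [y Ay <-]; exact: minx.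
by apply: lb_le_inf; [exists (f x), x | move=> _ [y Ay <-]; exact: minx].
Qed.

Definition orthogonal_mx (R : realType) (d : nat) : set 'M[R]_d :=
  [set Q | Q^T *m Q = 1%:M].

Definition closed_subgroup (R : realType) (d : nat) (G : set 'M[R]_d) : Prop :=
  [/\ G `<=` @orthogonal_mx R d,
      G 1%:M,
      (forall P Q, G P -> G Q -> G (P *m Q)),
      (forall Q, G Q -> G (invmx Q)) &
      closed G].

(* An nd x d matrix has type 'M_(\sum_(i < n) d, d), so that the block
   operations of mathcomp apply: its i-th d x d block is [submxcol Y i]. *)
Definition power_set (R : realType) (n d : nat) (G : set 'M[R]_d) :
    set 'M[R]_(\sum_(i < n) d, d) :=
  [set Y | forall i : 'I_n, G (submxcol Y i)].

Definition kron (R : realType) (n d : nat) (A : 'M[R]_n) (B : 'M[R]_d) :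
    'M[R]_(\sum_(i < n) d) :=
  \mxblock_(i < n, j < n) (A i j *: B).

Definition is_proj (R : realType) (d : nat) (G : set 'M[R]_d)
    (Pi : 'M[R]_d -> 'M[R]_d) : Prop :=
  forall X, argmin G (fun Q => frob (X - Q)) (Pi X).

Definition proj_n (R : realType) (n d : nat) (Pi : 'M[R]_d -> 'M[R]_d)
    (Y : 'M[R]_(\sum_(i < n) d, d)) : 'M[R]_(\sum_(i < n) d, d) :=
  \mxcol_(i < n) Pi (submxcol Y i).

Definition eps (R : realType) (n d : nat) (G : set 'M[R]_d)
    (Gstar Y : 'M[R]_(\sum_(i < n) d, d)) : R :=
  minval G (fun Q => frob (Y - Gstar *m Q)).

(* Only the values of Cobs on E are used. *)
Definition Cmx (R : realType) (n d : nat) (E : {set 'I_n * 'I_n})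
    (Cobs : 'I_n -> 'I_n -> 'M[R]_d) : 'M[R]_(\sum_(i < n) d) :=
  \mxblock_(i < n, j < n)
    (if (i, j) \in E then Cobs i j
     else if (j, i) \in E then (Cobs j i)^T
     else if i == j then 1%:M
     else 0).

Definition weight (R : realType) (n : nat) (E : {set 'I_n * 'I_n}) : 'M[R]_n :=
  \matrix_(i, j) [|| i == j, (i, j) \in E | (j, i) \in E]%:R.

Definition degree (R : realType) (n : nat) (E : {set 'I_n * 'I_n}) : 'rV[R]_n :=
  \row_i \sum_j weight R E i j.

Definition Dmx (R : realType) (n d : nat) (E : {set 'I_n * 'I_n}) :
    'M[R]_(\sum_(i < n) d) :=
  kron (diag_mx (degree R E)) (1%:M : 'M[R]_d).

Definition Wmx (R : realType) (n d : nat) (E : {set 'I_n * 'I_n}) :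
    'M[R]_(\sum_(i < n) d) :=
  kron (weight R E) (1%:M : 'M[R]_d).

Definition Fmx (R : realType) (n d : nat) : 'M[R]_(\sum_(i < n) d) :=
  let e := const_mx 1 : 'cV[R]_n in kron (e *m e^T) (1%:M : 'M[R]_d).

Definition kappa (R : realType) (n d : nat) (E : {set 'I_n * 'I_n}) : R :=
  opnorm (invmx (Dmx R d E) *m Wmx R d E - n%:R^-1 *: Fmx R n d).

Definition Delta (R : realType) (n d : nat) (E : {set 'I_n * 'I_n})
    (Cobs : 'I_n -> 'I_n -> 'M[R]_d) (Gstar : 'M[R]_(\sum_(i < n) d, d)) :
    'M[R]_(\sum_(i < n) d) :=
  \mxblock_(i < n, j < n)
    (weight R E i j *:
       (submxblock (Cmx E Cobs) i j - submxcol Gstar i *m (submxcol Gstar j)^T)).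

(* Main.v *)
(* Write <A, B> for the Frobenius inner product, Z = D^-1 Delta Gstar,
   S = Pi^n (Gstar + 2 Z), s = |S - Gstar|, P = G^(t+1), Q = Q^t and
   e = eps (G^t) = |G^t - Gstar Q|.  All elements of G^n have the same norm, so
   Pi^n maximises <Y, .> over G^n, and scaling the blocks of Y by the inverse
   degrees does not change the maximisers.  Now
   D^-1 C G^t = (Gstar + Z) Q + Er with |Er| <= (1/32 + 1/32 + 1/16) e = e / 8,
   the three terms being controlled by Delta, by kappa, and by (i) together with
   e <= sqrt n / (8 alpha).  Comparing the optimality of P against S Q with that
   of S against P Q^T eliminates Z and gives <Gstar Q + 2 Er, P - S Q> >= 0,
   hence |P - Gstar Q| <= s + 4 |Er| <= s + e / 2.  Iterating yields
   eps (G^t) <= 2^-t eps (G^0) + 2 s, which is stronger than the claim. *)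
Require Import Defs.
From mathcomp Require Import all_boot all_order all_algebra.
From mathcomp Require Import all_classical all_reals all_analysis.
From mathcomp Require Import ring lra.

Set Implicit Arguments.
Unset Strict Implicit.
Unset Printing Implicit Defensive.

Import Order.TTheory GRing.Theory Num.Theory.
Import numFieldNormedType.Exports.

Local Open Scope classical_set_scope.
Local Open Scope ring_scope.

(** * The Frobenius inner product and its norm *)

Definition mxdot (R : realType) (m n : nat) (A B : 'M[R]_(m, n)) : R :=
  \tr (A^T *m B).

Section Frobenius.
Variables (R : realType) (m n : nat).
Implicit Types (A B C : 'M[R]_(m, n)) (a : R).

Lemma mxdotE A B : mxdot A B = \sum_i \sum_j A i j * B i j.
Proof.
rewrite exchange_big; apply: eq_bigr => j _; rewrite mxE.
by apply: eq_bigr => i _; rewrite mxE.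
Qed.

Lemma mxdotC A B : mxdot A B = mxdot B A.
Proof. by rewrite /mxdot -mxtrace_tr trmx_mul trmxK. Qed.

Lemma mxdotDl A B C : mxdot (A + B) C = mxdot A C + mxdot B C.
Proof. by rewrite /mxdot linearD mulmxDl mxtraceD. Qed.

Lemma mxdotZl a A B : mxdot (a *: A) B = a * mxdot A B.
Proof. by rewrite /mxdot linearZ /= -scalemxAl mxtraceZ. Qed.

Lemma mxdotNl A B : mxdot (- A) B = - mxdot A B.
Proof. by rewrite -scaleN1r mxdotZl mulN1r. Qed.

Lemma mxdotBl A B C : mxdot (A - B) C = mxdot A C - mxdot B C.
Proof. by rewrite mxdotDl mxdotNl. Qed.

Lemma mxdotDr A B C : mxdot A (B + C) = mxdot A B + mxdot A C.
Proof. by rewrite ![mxdot A _]mxdotC mxdotDl. Qed.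

Lemma mxdotZr a A B : mxdot A (a *: B) = a * mxdot A B.
Proof. by rewrite ![mxdot A _]mxdotC mxdotZl. Qed.

Lemma mxdotBr A B C : mxdot A (B - C) = mxdot A B - mxdot A C.
Proof. by rewrite ![mxdot A _]mxdotC mxdotBl. Qed.

Lemma frob_ge0 A : 0 <= frob A.
Proof. exact: sqrtr_ge0. Qed.

Lemma sqr_frob A : frob A ^+ 2 = mxdot A A.
Proof.
rewrite mxdotE sqr_sqrtr; last by do 2!apply: sumr_ge0 => ? _; rewrite sqr_ge0.
by do 2!apply: eq_bigr => ? _; rewrite expr2.
Qed.

Lemma frob_eq0 A : (frob A == 0) = (A == 0).
Proof.
apply/eqP/eqP => [A0|->]; last first.
  by rewrite /frob big1 ?sqrtr0 // => i _; rewrite big1 // => j _; rewrite mxE expr0n.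
have : mxdot A A == 0 by rewrite -sqr_frob A0 expr0n.
rewrite mxdotE psumr_eq0 => [/allP h|i _]; last first.
  by apply: sumr_ge0 => j _; rewrite -expr2 sqr_ge0.
apply/matrixP => i j; rewrite mxE; have := h i (mem_index_enum _).
rewrite psumr_eq0 => [/allP/(_ j (mem_index_enum _))|k _].
  by rewrite mulf_eq0 orbb => /eqP.
by rewrite -expr2 sqr_ge0.
Qed.

Lemma frob0 : frob (0 : 'M[R]_(m, n)) = 0.
Proof. by apply/eqP; rewrite frob_eq0. Qed.

Lemma frobZ a A : frob (a *: A) = `|a| * frob A.
Proof.
apply/eqP; rewrite -(@eqrXn2 _ 2) ?mulr_ge0 ?frob_ge0 //.
by rewrite exprMn !sqr_frob mxdotZl mxdotZr mulrA -expr2 real_normK ?num_real.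
Qed.

(** Cauchy-Schwarz: expand the square of [frob B *: A - frob A *: B] and divide by the product of
    the norms. *)
Lemma mxdot_le A B : mxdot A B <= frob A * frob B.
Proof.
have [->|A0] := eqVneq A 0.
  by rewrite /mxdot trmx0 mul0mx mxtrace0 mulr_ge0 ?frob_ge0.
have [->|B0] := eqVneq B 0.
  by rewrite /mxdot mulmx0 mxtrace0 mulr_ge0 ?frob_ge0.
have a0 : 0 < frob A by rewrite lt0r frob_eq0 A0 frob_ge0.
have b0 : 0 < frob B by rewrite lt0r frob_eq0 B0 frob_ge0.
have := sqr_ge0 (frob (frob B *: A - frob A *: B)).
rewrite sqr_frob !mxdotBl !mxdotBr !mxdotZl !mxdotZr (mxdotC B A) -!sqr_frob.
by move=> h; rewrite -(ler_pM2l (mulr_gt0 a0 b0)); lra.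
Qed.

Lemma frobD A B : frob (A + B) <= frob A + frob B.
Proof.
rewrite -(@ler_pXn2r _ 2) ?nnegrE ?addr_ge0 ?frob_ge0 //.
rewrite sqr_frob mxdotDl !mxdotDr -!sqr_frob (mxdotC B A).
have := mxdot_le A B; lra.
Qed.

Lemma frobN A : frob (- A) = frob A.
Proof. by rewrite -scaleN1r frobZ normrN normr1 mul1r. Qed.

Lemma frobB A B : frob (A - B) <= frob A + frob B.
Proof. by rewrite -(frobN B) frobD. Qed.

End Frobenius.

(** * The operator norm against the Frobenius norm *)

Lemma sqr_frob_col (R : realType) m n (A : 'M[R]_(m, n)) : frob A ^+ 2 = \sum_j frob (col j A) ^+ 2.
Proof.
rewrite sqr_frob mxdotE exchange_big; apply: eq_bigr => j _.
rewrite sqr_frob mxdotE; apply: eq_bigr => i _.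
by rewrite big_ord1 !mxE.
Qed.

Lemma frob_tr (R : realType) m n (A : 'M[R]_(m, n)) : frob A^T = frob A.
Proof.
rewrite /frob exchange_big; congr Num.sqrt.
by do 2!apply: eq_bigr => ? _; rewrite mxE.
Qed.

Lemma sqr_frob_row (R : realType) m n (A : 'M[R]_(m, n)) : frob A ^+ 2 = \sum_i frob (row i A) ^+ 2.
Proof.
rewrite -frob_tr sqr_frob_col; apply: eq_bigr => i _.
by rewrite -tr_row frob_tr.
Qed.

(** Cauchy-Schwarz on each row. It shows that the set in [opnorm] is bounded above, so that its
    [sup] is a genuine supremum. *)
Lemma frob_mulmx_col (R : realType) m n (A : 'M[R]_(m, n))
    (x : 'cV[R]_n) : frob (A *m x) <= frob A * frob x.
Proof.
rewrite -(@ler_pXn2r _ 2) ?nnegrE ?mulr_ge0 ?frob_ge0 //.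
rewrite exprMn (sqr_frob_row A) mulr_suml sqr_frob mxdotE.
apply: ler_sum => i _; rewrite big_ord1 -expr2 -exprMn.
have -> : (A *m x) i 0 = mxdot (row i A)^T x.
  rewrite mxE mxdotE; apply: eq_bigr => j _; rewrite big_ord1.
  by rewrite !mxE.
rewrite -(frob_tr (row i A)) -[leLHS]real_normK ?num_real //.
rewrite ler_pXn2r ?nnegrE ?mulr_ge0 ?frob_ge0 // ler_norml mxdot_le andbT.
by rewrite lerNl -mxdotNl -frobN mxdot_le.
Qed.

Lemma opnorm_col (R : realType) m n (A : 'M[R]_(m, n))
    (x : 'cV[R]_n) : frob (A *m x) <= opnorm A * frob x.
Proof.
have [->|x0] := eqVneq x 0.
  by rewrite mulmx0 !frob0 mulr0.
have fx0 : 0 < frob x by rewrite lt0r frob_eq0 x0 frob_ge0.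
rewrite -ler_pdivrMr // mulrC -[_^-1]ger0_norm ?invr_ge0 ?frob_ge0 //.
rewrite -frobZ scalemxAr; apply: ub_le_sup; last first.
  exists ((frob x)^-1 *: x) => //=.
  by rewrite frobZ ger0_norm ?invr_ge0 ?frob_ge0 // mulVf ?gt_eqF.
exists (frob A) => _ [y /= y1 <-]; apply: le_trans (frob_mulmx_col A y) _.
by rewrite ler_piMr ?frob_ge0.
Qed.

Lemma opnorm_ge0 (R : realType) m n (A : 'M[R]_(m, n)) : 0 <= opnorm A.
Proof.
apply: ub_le_sup.
  exists (frob A) => _ [y /= y1 <-]; apply: le_trans (frob_mulmx_col A y) _.
  by rewrite ler_piMr ?frob_ge0.
exists 0 => /=; rewrite ?mulmx0 frob0 ?ler01 //.
Qed.

Lemma frob_mulmx (R : realType) (m n p : nat) (A : 'M[R]_(m, n))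
    (B : 'M[R]_(n, p)) : frob (A *m B) <= opnorm A * frob B.
Proof.
rewrite -(@ler_pXn2r _ 2) ?nnegrE ?mulr_ge0 ?frob_ge0 ?opnorm_ge0 //.
rewrite exprMn !(sqr_frob_col _) mulr_sumr; apply: ler_sum => j _.
rewrite -exprMn !colE -mulmxA ler_pXn2r ?nnegrE ?mulr_ge0 ?frob_ge0 ?opnorm_ge0 //.
exact: opnorm_col.
Qed.

Lemma mxdot_mulmxr (R : realType) m n p (A : 'M[R]_(m, n)) (B : 'M[R]_(m, p))
    (Q : 'M[R]_(n, p)) : mxdot (A *m Q) B = mxdot A (B *m Q^T).
Proof. by rewrite /mxdot trmx_mul mulmxA [RHS]mxtrace_mulC mulmxA. Qed.

Lemma mxdot_mulmxl (R : realType) m n p (A : 'M[R]_(m, n)) (B : 'M[R]_(p, n))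
    (U : 'M[R]_(p, m)) : mxdot (U *m A) B = mxdot A (U^T *m B).
Proof. by rewrite /mxdot trmx_mul mulmxA. Qed.

Lemma frob_orthogonal_l (R : realType) d m (U : 'M[R]_d) (A : 'M[R]_(d, m)) :
  U^T *m U = 1%:M -> frob (U *m A) = frob A.
Proof.
move=> UU; apply/eqP; rewrite -(@eqrXn2 _ 2) ?frob_ge0 // !sqr_frob.
by rewrite mxdot_mulmxl mulmxA UU mul1mx.
Qed.

Lemma frob_orthogonal_r (R : realType) d m (U : 'M[R]_d) (A : 'M[R]_(m, d)) :
  U *m U^T = 1%:M -> frob (A *m U) = frob A.
Proof.
move=> UU; apply/eqP; rewrite -(@eqrXn2 _ 2) ?frob_ge0 // !sqr_frob.
by rewrite mxdot_mulmxr -mulmxA UU mulmx1.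
Qed.

(** * Blockwise formulas and the inverse degree matrix *)

Section Blocks.
Variables (R : realType) (n d m : nat).
Implicit Types (X Y : 'M[R]_(\sum_(i < n) d, m)).

Lemma mxdot_blocks X Y :
  mxdot X Y = \sum_i mxdot (submxcol X i) (submxcol Y i).
Proof.
rewrite /mxdot -{1}(submxcolK X) -{1}(submxcolK Y) tr_mxcol mul_mxrow_mxcol.
by rewrite raddf_sum.
Qed.

Lemma sqr_frob_blocks X : frob X ^+ 2 = \sum_i frob (submxcol X i) ^+ 2.
Proof.
by rewrite sqr_frob mxdot_blocks; apply: eq_bigr => i _; rewrite sqr_frob.
Qed.

Lemma frob_mxcol_const (M : 'M[R]_(d, m)) :
  frob (\mxcol_(i < n) M) = Num.sqrt n%:R * frob M.
Proof.
apply/eqP; rewrite -(@eqrXn2 _ 2) ?mulr_ge0 ?sqrtr_ge0 ?frob_ge0 //.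
rewrite sqr_frob_blocks exprMn sqr_sqrtr //.
under eq_bigr do rewrite mxcolK.
by rewrite sumr_const card_ord mulr_natl.
Qed.

(** Lets blocks be rotated into the frames of the ground truth and back at no cost in norm. *)
Lemma frob_mxcol_orthogonal (U : 'I_n -> 'M[R]_d) X :
  (forall i, (U i)^T *m U i = 1%:M) ->
  frob (\mxcol_i (U i *m submxcol X i)) = frob X.
Proof.
move=> UU; apply/eqP; rewrite -(@eqrXn2 _ 2) ?frob_ge0 // !sqr_frob_blocks.
by apply/eqP/eq_bigr => i _; rewrite mxcolK frob_orthogonal_l.
Qed.

Lemma submxcolZ a X i : submxcol (a *: X) i = a *: submxcol X i.
Proof. by apply/matrixP => k l; rewrite !mxE. Qed.

Lemma submxcol_kron (A : 'M[R]_n) X i :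
  submxcol (kron A (1%:M : 'M[R]_d) *m X) i = \sum_j A i j *: submxcol X j.
Proof.
rewrite -{1}(submxcolK X) mul_mxblock_mxrow mxcolK.
by apply: eq_bigr => j _; rewrite -scalemxAl mul1mx.
Qed.

Lemma submxcol_mxblock (B : forall i j : 'I_n, 'M[R]_d) X i :
  submxcol (\mxblock_(i, j) B i j *m X) i = \sum_j B i j *m submxcol X j.
Proof. by rewrite -{1}(submxcolK X) mul_mxblock_mxrow mxcolK. Qed.

End Blocks.

Lemma degree_gt0 (R : realType) n (E : {set 'I_n * 'I_n}) i :
  0 < degree R E 0 i.
Proof.
rewrite mxE (bigD1 i) //= mxE eqxx ltr_wpDr //.
by apply: sumr_ge0 => j _; rewrite mxE.
Qed.

Lemma submxcol_kron_diag (R : realType) n d m (r : 'rV[R]_n)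
    (X : 'M[R]_(\sum_(i < n) d, m)) i :
  submxcol (kron (diag_mx r) (1%:M : 'M[R]_d) *m X) i = r 0 i *: submxcol X i.
Proof.
rewrite submxcol_kron (bigD1 i) //= mxE eqxx big1 ?addr0 // => j ji.
by rewrite mxE eq_sym (negbTE ji) scale0r.
Qed.

Lemma Dmx_unit (R : realType) n d (E : {set 'I_n * 'I_n}) :
  Dmx R d E \in unitmx.
Proof.
set K := kron (diag_mx (\row_i (degree R E 0 i)^-1)) (1%:M : 'M[R]_d).
(* The factor [1%:M] gives [K] the shape that [submxcol_kron_diag] rewrites. *)
suff /mulmx1_unit[] : Dmx R d E *m (K *m 1%:M) = 1%:M by [].
apply/mxcolP => i; rewrite !submxcol_kron_diag scalerA [X in _ * X]mxE divff ?scale1r //.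
by rewrite gt_eqF ?degree_gt0.
Qed.

Lemma submxcol_invDmx (R : realType) n d m (E : {set 'I_n * 'I_n})
    (X : 'M[R]_(\sum_(i < n) d, m)) i :
  submxcol (invmx (Dmx R d E) *m X) i = (degree R E 0 i)^-1 *: submxcol X i.
Proof.
rewrite -{2}(mulKVmx (Dmx_unit R d E) X) submxcol_kron_diag scalerA mulVf.
  by rewrite scale1r.
by rewrite gt_eqF ?degree_gt0.
Qed.

(** * Projection onto the group as maximisation of an inner product *)

Section Projection.
Variables (R : realType) (n d : nat) (G : set 'M[R]_d).
Hypothesis subG : G `<=` @orthogonal_mx R d.
Implicit Types (X Y P : 'M[R]_(\sum_(i < n) d, d)).

Lemma mxdot_subgroup (Q : 'M[R]_d) : G Q -> mxdot Q Q = d%:R.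
Proof. by move=> GQ; rewrite /mxdot (subG GQ) mxtrace1. Qed.

Lemma mxdot_power_set P : power_set G P -> mxdot P P = (n * d)%:R.
Proof.
move=> GP; rewrite mxdot_blocks (eq_bigr (fun=> d%:R)) => [|i _].
  by rewrite sumr_const card_ord mulnC natrM mulr_natr.
exact: mxdot_subgroup.
Qed.

(** All elements of [G] have squared norm [d], so expanding the squared distance leaves only the
    cross term to compare. *)
Lemma mxdot_proj_le Pi (M Q : 'M[R]_d) :
  is_proj G Pi -> G Q -> mxdot M Q <= mxdot M (Pi M).
Proof.
move=> hPi GQ; have [GPi /(_ _ GQ)] := hPi M.
rewrite -(@ler_pXn2r _ 2) ?nnegrE ?frob_ge0 // !sqr_frob !mxdotBl !mxdotBr.
rewrite (mxdotC Q) (mxdotC (Pi M)) (mxdot_subgroup GQ) (mxdot_subgroup GPi); lra.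
Qed.

(** Blocks are maximised independently, so positive factors [c i] do not move the maximiser; this is
    how the inverse degrees enter although the method projects without them. *)
Lemma mxdot_proj_n_le Pi (c : 'I_n -> R) X Y P :
  is_proj G Pi -> power_set G P -> (forall i, 0 < c i) ->
  (forall i, submxcol X i = c i *: submxcol Y i) ->
  mxdot X P <= mxdot X (proj_n Pi Y).
Proof.
move=> hPi GP c0 XY; rewrite !mxdot_blocks; apply: ler_sum => i _.
by rewrite mxcolK XY !mxdotZl ler_pM2l // mxdot_proj_le.
Qed.

Lemma proj_n_in Pi Y : is_proj G Pi -> power_set G (proj_n Pi Y).
Proof. by move=> hPi i; rewrite mxcolK; case: (hPi (submxcol Y i)). Qed.

Lemma power_set_mulr P Q :
  (forall A B, G A -> G B -> G (A *m B)) ->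
  power_set G P -> G Q -> power_set G (P *m Q).
Proof. by move=> GM GP GQ i; rewrite -submxcol_mul; apply: GM. Qed.

(* Adding the two optimality conditions, tested against [S *m Q] and
   [P *m Q^T], cancels [Z] and leaves [0 <= mxdot (Gs *m Q + 2 *: Er) (P - S *m Q)]. *)
Lemma perturbed_proj_le (Gs Z Er S P : 'M[R]_(\sum_(i < n) d, d)) Q :
  (forall A B, G A -> G B -> G (A *m B)) ->
  power_set G Gs -> power_set G S -> power_set G P -> G Q -> G Q^T ->
  (forall T, power_set G T -> mxdot (Gs + 2 *: Z) T <= mxdot (Gs + 2 *: Z) S) ->
  (forall T, power_set G T ->
     mxdot ((Gs + Z) *m Q + Er) T <= mxdot ((Gs + Z) *m Q + Er) P) ->
  frob (P - Gs *m Q) <= frob (S - Gs) + 4 * frob Er.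
Proof.
move=> GM GGs GS GP GQ GQT optS optP.
have QQT : Q *m Q^T = 1%:M by rewrite mulmx1C //; exact: subG.
have GSQ := power_set_mulr GM GS GQ.
have GGQ := power_set_mulr GM GGs GQ.
have : mxdot ((Gs + 2 *: Z) *m Q) P <= mxdot ((Gs + 2 *: Z) *m Q) (S *m Q).
  rewrite !mxdot_mulmxr -mulmxA QQT mulmx1.
  exact/optS/(power_set_mulr GM GP GQT).
have := optP _ GSQ.
rewrite !mulmxDl -scalemxAl !mxdotDl !mxdotZl => h1 h2.
have hs : frob (S - Gs) = frob (S *m Q - Gs *m Q).
  by rewrite -mulmxBl frob_orthogonal_r.
have cs := mxdot_le Er (P - S *m Q).
have tri : frob (P - S *m Q) <= frob (P - Gs *m Q) + frob (S - Gs).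
  rewrite hs; apply: le_trans (frobB _ _).
  by rewrite opprB addrA subrK.
have e0 := frob_ge0 Er.
have p0 := frob_ge0 (P - Gs *m Q); have s0 := frob_ge0 (S - Gs).
(* Elements of the power set all have squared norm [n * d], so distances reduce to inner
   products. *)
have hp2 : frob (P - Gs *m Q) ^+ 2 = 2 * (n * d)%:R - 2 * mxdot (Gs *m Q) P.
  rewrite sqr_frob !mxdotBl !mxdotBr (mxdotC P (Gs *m Q)).
  by rewrite (mxdot_power_set GP) (mxdot_power_set GGQ); ring.
have hs2 : frob (S - Gs) ^+ 2 = 2 * (n * d)%:R - 2 * mxdot (Gs *m Q) (S *m Q).
  rewrite hs sqr_frob !mxdotBl !mxdotBr (mxdotC (S *m Q) (Gs *m Q)).
  by rewrite (mxdot_power_set GSQ) (mxdot_power_set GGQ); ring.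
rewrite mxdotBr in cs.
set p := frob (P - Gs *m Q) in tri p0 hp2 *; set s := frob (S - Gs) in tri s0 hs2 *.
set e := frob Er in cs e0 *.
have cs2 : e * frob (P - S *m Q) <= e * (p + s) by rewrite ler_wpM2l.
(* Twice [h1] plus [h2] cancels [Z]; by [hp2] and [hs2] this reads p^2 - s^2 <= 4 <Er, P - S Q>,
   which [cs] and [cs2] bound. *)
have key : (p - s) * (p + s) <= 4 * e * (p + s) by lra.
rewrite leNgt; apply/negP => lt.
have ps : 0 < p + s by lra.
by move: key; rewrite ler_pM2r //; lra.
Qed.

End Projection.

(** * Splitting one power step into signal and error *)

Section Decomposition.
Variables (R : realType) (n d : nat) (E : {set 'I_n * 'I_n}).
Variables (Cobs : 'I_n -> 'I_n -> 'M[R]_d).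
Variables (Gs Y : 'M[R]_(\sum_(i < n) d, d)).

(** [Cmx] vanishes wherever the weight does, so the weighting inside [Delta] loses none of its
    blocks. *)
Lemma weight_Cmx i j :
  weight R E i j *: submxblock (Cmx E Cobs) i j = submxblock (Cmx E Cobs) i j.
Proof.
rewrite mxblockK mxE.
by do 3![case: ifP => _; rewrite ?orbT ?scale1r //]; rewrite scaler0.
Qed.

Lemma submxcol_Cmx i :
  submxcol (Cmx E Cobs *m Y) i =
  submxcol (Delta E Cobs Gs *m Y) i
  + submxcol Gs i *m \sum_j weight R E i j *: ((submxcol Gs j)^T *m submxcol Y j).
Proof.
rewrite -{1}(submxblockK (Cmx E Cobs)) !submxcol_mxblock mulmx_sumr -big_split.
apply: eq_bigr => j _ /=.
rewrite -{1}weight_Cmx scalerBr mulmxBl -!scalemxAl -scalemxAr mulmxA.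
by rewrite subrK.
Qed.

Let K := invmx (Dmx R d E) *m Wmx R d E - n%:R^-1 *: Fmx R n d.
(** Here [Z] omits the last factor [Gs], which is written out where it is needed. *)
Let Z := invmx (Dmx R d E) *m Delta E Cobs Gs.

Lemma submxcol_K (X : 'M[R]_(\sum_(i < n) d, d)) i :
  submxcol (K *m X) i =
  (degree R E 0 i)^-1 *: (\sum_j weight R E i j *: submxcol X j)
  - n%:R^-1 *: \sum_j submxcol X j.
Proof.
rewrite mulmxBl submxcolB -mulmxA submxcol_invDmx submxcol_kron; congr (_ - _).
rewrite -scalemxAl submxcolZ submxcol_kron; congr (_ *: _).
by apply: eq_bigr => j _; rewrite mxE big_ord1 !mxE mulr1 scale1r.
Qed.

Lemma tr_mulmx_blocks (A B : 'M[R]_(\sum_(i < n) d, d)) :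
  A^T *m B = \sum_i (submxcol A i)^T *m submxcol B i.
Proof.
by rewrite -{1}(submxcolK A) -{1}(submxcolK B) tr_mxcol mul_mxrow_mxcol.
Qed.

(** Put T_j = Gs_j^T Y_j - Q. The noiseless part is Gs_i times the weighted average of Q + T_j. On T
    that average is [K] plus the plain mean, and the mean of T is (Gs^T Y - n Q) / n. *)
Lemma gpm_decomposition (Q : 'M[R]_d) :
  (0 < n)%N ->
  (forall i, (submxcol Gs i)^T *m submxcol Gs i = 1%:M) ->
  invmx (Dmx R d E) *m (Cmx E Cobs *m Y) =
  (Gs + Z *m Gs) *m Q
  + (Z *m (Y - Gs *m Q)
     + \mxcol_i (submxcol Gs i *m submxcol
          (K *m \mxcol_j ((submxcol Gs j)^T *m submxcol (Y - Gs *m Q) j)) i)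
     + \mxcol_i (submxcol Gs i *m
          submxcol (\mxcol_(j < n) (n%:R^-1 *: (Gs^T *m Y - n%:R *: Q))) i)).
Proof.
move=> n0 GG; have n0R : n%:R != 0 :> R by rewrite pnatr_eq0 -lt0n.
apply/mxcolP => i; rewrite submxcol_invDmx submxcol_Cmx !submxcolD !mxcolK.
rewrite mulmxBr mulmxDl submxcolB !submxcolD submxcol_K tr_mulmx_blocks.
have tE j : submxcol (\mxcol_j ((submxcol Gs j)^T *m submxcol (Y - Gs *m Q) j)) j
    = (submxcol Gs j)^T *m submxcol Y j - Q.
  by rewrite mxcolK submxcolB mulmxBr -submxcol_mul mulmxA GG mul1mx.
under [X in _^-1 *: X - _]eq_bigr do rewrite tE scalerBr.
under [X in _ - _ *: X]eq_bigr do rewrite tE.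
have wQ : \sum_j weight R E i j *: Q = degree R E 0 i *: Q.
  by rewrite -scaler_suml mxE.
have sQ : \sum_(j < n) Q = n%:R *: Q by rewrite sumr_const card_ord scaler_nat.
rewrite !sumrB wQ sQ !(mulmxBr, scalerBr, scalerDr) !scalerA.
rewrite (mulVf n0R) mulVf ?(gt_eqF (degree_gt0 R E i)) // !scale1r.
rewrite -(submxcol_mul Gs) -(mulmxA Z Gs) -(mulmxA _ _ Y) submxcol_invDmx scalemxAr.
by move: (_ *: _) (submxcol Gs i *m _) => *; apply/matrixP => k l; rewrite !mxE; ring.
Qed.

End Decomposition.

(** * Error recurrence along the iteration *)

(** The step is available only below [b], so that bound is carried through the induction; s <= b / 2
    preserves it. The factor 2 is the sum of the powers of 1/2. *)
Lemma affine_recurrence_le (R : realType) (f : nat -> R) (b s : R) :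
  0 <= s -> s <= b / 2 -> 0 <= f 0%N <= b ->
  (forall t, f t <= b -> f t.+1 <= f t / 2 + s) ->
  forall t, f t <= b /\ f t <= (1 / 2) ^+ t * f 0%N + 2 * s.
Proof.
move=> s0 sb /andP[f0 fb] step; elim=> [|t [IHb IH]].
  by split; rewrite // expr0 mul1r; lra.
have := step t IHb; rewrite exprS -mulrA; set u := _ * f 0%N in IH *.
by move=> h; split; lra.
Qed.

Lemma gpm_error_le (R : realType) (n d : nat) (E : {set 'I_n * 'I_n})
    (Cobs : 'I_n -> 'I_n -> 'M[R]_d) (Gs Y : 'M[R]_(\sum_(i < n) d, d))
    (Q : 'M[R]_d) (alpha : R) :
  (0 < n)%N -> 0 < alpha ->
  (forall i, (submxcol Gs i)^T *m submxcol Gs i = 1%:M) ->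
  frob (Gs^T *m Y - n%:R *: Q) <= alpha / 2 * frob (Y - Gs *m Q) ^+ 2 ->
  kappa R d E <= 1 / 32 ->
  opnorm (invmx (Dmx R d E) *m Delta E Cobs Gs) <= 1 / 32 ->
  frob (Y - Gs *m Q) <= Num.sqrt n%:R / (8 * alpha) ->
  exists2 Er, invmx (Dmx R d E) *m (Cmx E Cobs *m Y) =
      (Gs + invmx (Dmx R d E) *m Delta E Cobs Gs *m Gs) *m Q + Er
    & frob Er <= frob (Y - Gs *m Q) / 8.
Proof.
move=> n0 a0 GG hi hk hD he; have GGt i := mulmx1C (GG i).
eexists; first exact: gpm_decomposition.
have e0 := frob_ge0 (Y - Gs *m Q).
set e := frob (Y - _) in hi he e0 *.
apply: le_trans (frobD _ _) _.
apply: le_trans (lerD (frobD _ _) (lexx _)) _.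
rewrite !frob_mxcol_orthogonal // frob_mxcol_const frobZ.
have h1 := le_trans (frob_mulmx _ _) (ler_wpM2r e0 hD).
have h2 : frob ((invmx (Dmx R d E) *m Wmx R d E - n%:R^-1 *: Fmx R n d) *m
    \mxcol_j ((submxcol Gs j)^T *m submxcol (Y - Gs *m Q) j)) <= 1 / 32 * e.
  apply: le_trans (frob_mulmx _ _) _.
  (* The blocks T_j are those of [Y - Gs *m Q] rotated by Gs_j^T, so their column has norm [e]. *)
  rewrite (frob_mxcol_orthogonal (U := fun j => (submxcol Gs j)^T)).
    exact: ler_wpM2r.
  by move=> i; rewrite trmxK.
have n0R : 0 < n%:R :> R by rewrite ltr0n.
set r := Num.sqrt n%:R in he *.
have r0 : 0 < r by rewrite sqrtr_gt0.
have rr : n%:R = r ^+ 2 :> R by rewrite sqr_sqrtr.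
(* One factor [e] of the quadratic bound [hi] is absorbed by [he]: alpha/2 * e^2 <= r e / 16. *)
have h3 : r * (`|n%:R^-1| * frob (Gs^T *m Y - n%:R *: Q)) <= e / 16.
  rewrite ger0_norm ?invr_ge0 // [X in X^-1]rr.
  have -> x : r * (r ^- 2 * x) = x / r by field; rewrite gt_eqF.
  rewrite ler_pdivrMr //; apply: le_trans hi _.
  move: he; rewrite ler_pdivlMr ?mulr_gt0 // => he.
  have := ler_wpM2l e0 he; lra.
by move: h1 h2 h3; rewrite -/e; lra.
Qed.

Theorem theorem1 (R : realType) (d n : nat) (hd : (1 <= d)%N) (hn : (1 <= n)%N)
  (G : set 'M[R]_d) (hG : closed_subgroup G)
  (Gstar : 'M[R]_(\sum_(i < n) d, d)) (hGstar : power_set G Gstar)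
  (E : {set 'I_n * 'I_n})
  (hE : forall i j : 'I_n, (i, j) \in E -> (i < j)%N)
  (Cobs : 'I_n -> 'I_n -> 'M[R]_d)
  (Pi : 'M[R]_d -> 'M[R]_d) (hPi : is_proj G Pi)
  (Gs : nat -> 'M[R]_(\sum_(i < n) d, d))
  (hGs0 : power_set G (Gs 0%N))
  (hGsS : forall t : nat, Gs t.+1 = proj_n Pi (Cmx E Cobs *m Gs t))
  (Q : nat -> 'M[R]_d)
  (hQ : forall t : nat, argmin G (fun P => frob (Gs t - Gstar *m P)) (Q t))
  (alpha : R) (halpha : 1 <= alpha)
  (h_i : forall t : nat,
     frob (Gstar^T *m Gs t - n%:R *: Q t)
       <= alpha / 2 * frob (Gs t - Gstar *m Q t) ^+ 2)
  (h_ii : kappa R d E <= 1 / 32)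
  (h_iii1 : opnorm (invmx (Dmx R d E) *m Delta E Cobs Gstar) <= 1 / 32)
  (h_iii2 :
     frob (proj_n Pi (Gstar
             + 2 *: (invmx (Dmx R d E) *m Delta E Cobs Gstar *m Gstar)) - Gstar)
       <= (Num.sqrt 2 - 1) * Num.sqrt n%:R / (48 * alpha))
  (h_iv : eps G Gstar (Gs 0%N) <= Num.sqrt n%:R / (8 * alpha)) :
  forall t : nat, (1 <= t)%N ->
    eps G Gstar (Gs t)
      <= (1 / Num.sqrt 2) ^+ t * eps G Gstar (Gs 0%N)
         + 6 * (Num.sqrt 2 + 1)
           * frob (proj_n Pi (Gstar
               + 2 *: (invmx (Dmx R d E) *m Delta E Cobs Gstar *m Gstar))
               - Gstar).
Proof.
case: hG => subG G1 GM GV _.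
have GGs i : (submxcol Gstar i)^T *m submxcol Gstar i = 1%:M.
  exact/subG/hGstar.
(* For an orthogonal matrix the transpose is the inverse, so [GV] applies. *)
have GT A : G A -> G A^T.
  move=> GA; have AA := subG _ GA; have [_ uA] := mulmx1_unit AA.
  by rewrite -[A^T]mulmx1 -(mulmxV uA) mulmxA AA mul1mx; exact: GV.
have a0 : 0 < alpha by lra.
set Z := invmx (Dmx R d E) *m Delta E Cobs Gstar *m Gstar in h_iii2 *.
set S := proj_n Pi (Gstar + 2 *: Z) in h_iii2 *.
set s := frob (S - Gstar) in h_iii2 *.
have epsE t : eps G Gstar (Gs t) = frob (Gs t - Gstar *m Q t).
  exact: minvalE (hQ t).
have GGt t : power_set G (Gs t).
  by case: t => [//|t]; rewrite hGsS; exact: proj_n_in.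
have GS : power_set G S by exact: proj_n_in.
have step t : eps G Gstar (Gs t) <= Num.sqrt n%:R / (8 * alpha) ->
    eps G Gstar (Gs t.+1) <= eps G Gstar (Gs t) / 2 + s.
  rewrite !epsE => le_e; have [GQ _] := hQ t; have [_ minQ] := hQ t.+1.
  (* The previous alignment [Q t] competes in the minimum defining the next error. *)
  apply: le_trans (minQ _ GQ) _.
  have [Er defC leEr] := gpm_error_le hn a0 GGs (h_i t) h_ii h_iii1 le_e.
  suff : frob (Gs t.+1 - Gstar *m Q t) <= s + 4 * frob Er by lra.
  apply: (perturbed_proj_le subG (Z := Z)) => // [|T GT'|T GT']; first exact: GT.
    apply: (mxdot_proj_n_le subG (c := fun=> 1)) => // i.
    by rewrite scale1r.
  (* The new iterate projects [Cmx E Cobs *m Gs t], whose blocks differ from those of the decomposed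
     matrix by the inverse degrees. *)
  rewrite -defC hGsS.
  apply: (mxdot_proj_n_le subG (c := fun i => (degree R E 0 i)^-1)) => // i.
    by rewrite invr_gt0 degree_gt0.
  exact: submxcol_invDmx.
move=> t _.
have s0 : 0 <= s := frob_ge0 _.
have sq2 : 1 <= Num.sqrt 2 :> R by rewrite -[leLHS]sqrtr1 ler_wsqrtr // ler1n.
have sq2' : Num.sqrt 2 <= 2 :> R.
  by rewrite -(@ler_pXn2r _ 2) ?nnegrE ?sqrtr_ge0 // sqr_sqrtr //; lra.
have e0 : 0 <= eps G Gstar (Gs 0%N) by rewrite epsE frob_ge0.
(* Half the threshold is 3 sqrt n / (48 alpha), and sqrt 2 - 1 <= 3. *)
have sb : s <= Num.sqrt n%:R / (8 * alpha) / 2.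
  apply: le_trans h_iii2 _.
  have -> : Num.sqrt n%:R / (8 * alpha) / 2 = 3 * Num.sqrt n%:R / (48 * alpha).
    by field; rewrite gt_eqF.
  rewrite ler_pM2r ?invr_gt0 ?mulr_gt0 // ler_wpM2r ?sqrtr_ge0 //; lra.
have [_] := affine_recurrence_le s0 sb (introT andP (conj e0 h_iv)) step t.
(* Weaken the constants: 1/2 <= 1/sqrt 2 and 2 <= 6 (sqrt 2 + 1). *)
move=> /le_trans -> //; apply: lerD.
  apply: ler_wpM2r => //; apply: lerXn2r; rewrite ?nnegrE.
  1,2: by rewrite divr_ge0 ?sqrtr_ge0.
  by rewrite !div1r lef_pV2 // ?posrE; lra.
by apply: ler_wpM2r => //; lra.
Qed.
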